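(* Let $b \ge 2$ be an integer, let $x_n$ be the base $b$ van der Corput sequence, and let $1 \le p < \infty$ be a real number. There exists a positive constant $A$ depending only on $p$ such that for any integer $M > b$ and any real number $\lambda \ge 1$ we have \[ \frac{1}{M} \left| \left\{ 0 \le N < M : \left| \left\| \Delta_N \right\|_p - \frac{b^2-1}{12 b} \log_b N \right| \ge A \lambda b \sqrt{\log_b N} \right\} \right| \le e^{- \sqrt{\lambda}} . \]
   Context: For an integer $b \ge 2$, the base $b$ van der Corput sequence $(x_n)_{n\ge 0}$ is defined as follows: if $n = \sum_{i=1}^m a_i b^{i-1}$ with digits $a_i \in \{0,1,\dots,b-1\}$, then $x_n = \sum_{i=1}^m a_i b^{-i}$. The discrepancy function is $\Delta_N(x) = |\{0 \le n < N : x_n < x\}| - Nx$ for integers $N \ge 0$ and $x \in [0,1]$, and $\|\Delta_N\|_p = \left( \int_0^1 |\Delta_N(x)|^p\,\mathrm{d}x \right)^{1/p}$.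
   Formalization: The set counts only 2 ≤ N < M (factor 1/M unchanged): log_b 0 is undefined, and for N = 1 the condition reads ‖Δ_1‖_p ≥ 0, always true, so the printed bound fails once λ > (ln M)^2. *)

(* Defs.v *)
From HB Require Import structures.
From mathcomp Require Import all_boot all_order all_algebra.
From mathcomp Require Import all_classical all_reals all_analysis.

Set Implicit Arguments.
Unset Strict Implicit.
Unset Printing Implicit Defensive.

Import Order.TTheory GRing.Theory Num.Theory.
Import numFieldNormedType.Exports.

Local Open Scope classical_set_scope.
Local Open Scope ring_scope.

(* [(n %/ b ^ i) %% b] is the coefficient of [b ^ i] in the base [b] expansion
   of [n].  The range [i < n] is long enough because [n < b ^ n] for [1 < b];
   see [vdcE] below. *)
Definition vdc (R : realType) (b n : nat) : R :=
  \sum_(i < n) ((n %/ b ^ i) %% b)%:R / b%:R ^+ i.+1.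

Definition Delta (R : realType) (b N : nat) (x : R) : R :=
  #|[pred n : 'I_N | vdc R b n < x]|%:R - N%:R * x.

Definition normDelta (R : realType) (b : nat) (p : R) (N : nat) : R :=
  (\int[lebesgue_measure]_(x in `[0, 1]) (`|Delta b N x| `^ p)) `^ p^-1.

(* Only meaningful for [0 < N]: in the library [ln 0 = 0]. *)
Definition logb (R : realType) (b N : nat) : R := ln N%:R / ln b%:R.

Lemma digitE (b m : nat) (a : nat -> nat) (j : nat) :
    (1 < b)%N -> (forall i, (a i < b)%N) ->
  (((\sum_(i < m) a i * b ^ i) %/ b ^ j) %% b = if j < m then a j else 0)%N.
Proof.
move=> b1; elim: j m a => [|j IH] [|m] a ab; rewrite ?big_ord0 ?div0n ?mod0n //.
all: have -> : (\sum_(i < m.+1) a i * b ^ i =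
    a 0 + b * \sum_(i < m) a i.+1 * b ^ i)%N.
1, 3: rewrite big_ord_recl expn0 muln1 big_distrr /=; congr addn;
  by apply: eq_bigr => i _; rewrite /bump /= add1n expnS mulnCA.
- by rewrite expn0 divn1 mulnC addnC modnMDl modn_small.
- have E q : ((a 0 + b * q) %/ b = q)%N.
    by rewrite addnC mulnC divnMDl ?(ltnW b1) // divn_small ?addn0.
  rewrite expnS divnMA E.
  exact: (IH m (fun i => a i.+1)).
Qed.

Lemma vdcE (R : realType) (b m : nat) (a : nat -> nat) :
    (1 < b)%N -> (forall i, (a i < b)%N) ->
  vdc R b (\sum_(i < m) a i * b ^ i)%N =
  \sum_(i < m) (a i)%:R / b%:R ^+ i.+1.
Proof.
move=> b1 ab; rewrite /vdc; set n := (\sum_(i < m) _)%N.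
pose F i : R := ((n %/ b ^ i) %% b)%:R / b%:R ^+ i.+1.
transitivity (\sum_(i < m) F i); last first.
  by apply: eq_bigr => i _; rewrite /F digitE // ltn_ord.
have Fn i : (n <= i)%N -> F i = 0.
  move=> ni; rewrite /F divn_small ?mod0n ?mul0r //.
  exact: leq_ltn_trans ni (ltn_expl _ b1).
have Fm i : (m <= i)%N -> F i = 0.
  by move=> mi; rewrite /F digitE // ltnNge mi /= mul0r.
have widen k l : (forall i, (k <= i)%N -> F i = 0) ->
    \sum_(i < k + l) F i = \sum_(i < k) F i.
  move=> F0; rewrite big_split_ord /= [X in _ + X]big1 ?addr0 // => i _.
  by rewrite F0 // leq_addr.
by rewrite -[LHS](widen n m Fn) addnC (widen m n Fm).
Qed.

(* Main.v *)
Require Import Defs.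
From HB Require Import structures.
From mathcomp Require Import all_boot all_order all_algebra.
From mathcomp Require Import all_classical all_reals all_analysis.
From mathcomp Require Import measurable_realfun.
From mathcomp Require Import ring lra zify.

Set Implicit Arguments.
Unset Strict Implicit.
Unset Printing Implicit Defensive.

Import Order.TTheory GRing.Theory Num.Theory.
Import numFieldNormedType.Exports.

Local Open Scope classical_set_scope.
Local Open Scope ring_scope.

(** Let [Z_N] be the average of [Delta_N] and [Delta_(N+1)].  Prepending a lowest
    digit [a] to [N] and a first digit [xi] to [u] changes [Z] by a bounded
    amount, and for every fixed [N] and [u] the average over all [b ^ 2] pairs
    [(a, xi)] of [Z_(bN+a) ((xi + u) / b) - Z_N u] is exactly
    [(b ^ 2 - 1) / (12 b)].  Hence, with [k] digits of [N] and a point [x] of a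
    [b]-adic grid drawn uniformly, [Z_N x] minus its mean is a martingale with
    increments bounded by [2 b], and its exponential moments at scale
    [1 / (b sqrt k)] are bounded.  Since [Delta_N] varies by at most [1] between
    neighbouring grid points and [y ^ p] is dominated by [e ^ y], Markov's
    inequality in [N] bounds the number of [N] with a fixed leading digit for
    which the [L_p] distance of [Delta_N] to a constant is large, and Minkowski's
    inequality compares that distance with the norm of [Delta_N]. *)

(** * The sequence: digit recursion and grid values *)

Lemma vdcS (R : realType) (b N a : nat) : (1 < b)%N -> (a < b)%N ->
  vdc R b (b * N + a) = (a%:R + vdc R b N) / b%:R.
Proof.
move=> b1 ab.
have bN0 : b%:R != 0 :> R by rewrite pnatr_eq0 -lt0n ltnW.
pose F n i : R := ((n %/ b ^ i) %% b)%:R / b%:R ^+ i.+1.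
have vdc_widen n m : (n <= m)%N -> vdc R b n = \sum_(i < m) F n i.
  move=> nm; rewrite -(subnKC nm) big_split_ord /= [X in _ + X]big1 ?addr0 //.
  move=> i _; rewrite /F divn_small ?mod0n ?mul0r //.
  exact: leq_ltn_trans (leq_addr _ _) (ltn_expl _ b1).
rewrite mulnC (@vdc_widen _ (N * b + a).+1) // (@vdc_widen N (N * b + a)); last first.
  by rewrite (leq_trans _ (leq_addr _ _)) // leq_pmulr // ltnW.
rewrite big_ord_recl /F expn0 divn1 modnMDl modn_small // expr1 mulrDl.
congr (_ + _); rewrite mulr_suml; apply: eq_bigr => i _.
rewrite lift0 expnS divnMA divnMDl ?(ltnW b1) // (divn_small ab) addn0.
by rewrite [in LHS]exprSr invfM mulrA.
Qed.

Lemma vdc0 (R : realType) (b : nat) : vdc R b 0 = 0.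
Proof. by rewrite /vdc big_ord0. Qed.

(** Induction on [K], removing the lowest digit of [n], which becomes the most significant digit of
    [c]. *)
Lemma vdc_grid (R : realType) (b K n : nat) : (1 < b)%N -> (n < b ^ K)%N ->
  exists2 c : nat, (c < b ^ K)%N & vdc R b n = c%:R / b%:R ^+ K.
Proof.
move=> b1; have b0 := ltnW b1; have bN0 : b%:R != 0 :> R by rewrite pnatr_eq0 -lt0n.
elim: K n => [|K IH] n; first by case: n => // _; exists 0%N; rewrite // vdc0 mul0r.
rewrite expnS => nK.
have [c cK E] := IH (n %/ b)%N ltac:(by rewrite ltn_divLR // mulnC).
have rb : (n %% b < b)%N by rewrite ltn_mod.
exists (n %% b * b ^ K + c)%N.
  rewrite (leq_trans (n := (n %% b).+1 * b ^ K)) //.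
    by rewrite mulSn addnC ltn_add2r.
  by rewrite leq_mul2r rb orbT.
rewrite {1}(divn_eq n b) mulnC vdcS // E natrD natrM natrX exprS.
by field; rewrite bN0 expf_neq0.
Qed.

Lemma vdc_itv (R : realType) (b n : nat) : (1 < b)%N -> 0 <= vdc R b n < 1.
Proof.
move=> b1; have [c cn ->] := @vdc_grid R b n n b1 (ltn_expl n b1).
have bn0 : 0 < b%:R ^+ n :> R by rewrite exprn_gt0 // ltr0n ltnW.
by rewrite divr_ge0 ?(ltW bn0) //= ltr_pdivrMr // mul1r -natrX ltr_nat.
Qed.

(** * The discrepancy function and its recursion along the digits *)

Lemma DeltaE (R : realType) (b N : nat) (x : R) :
  Delta b N x = \sum_(0 <= n < N) ((vdc R b n < x)%R%:R - x).
Proof.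
rewrite sumrB sumr_const_nat subn0 big_mkord /Delta mulr_natl; congr (_ - _).
rewrite -sum1_card natr_sum [LHS]big_mkcond /=; apply: eq_bigr => i _.
by rewrite inE; case: (_ < _)%R.
Qed.

Lemma norm_indic_sub_le1 (R : realType) (B : bool) (x : R) :
  0 <= x <= 1 -> `|B%:R - x| <= 1.
Proof. by case: B => /andP[x0 x1]; rewrite ler_norml /=; apply/andP; split; lra. Qed.

Lemma norm_Delta_le (R : realType) (b N : nat) (x : R) :
  0 <= x <= 1 -> `|Delta b N x| <= N%:R.
Proof.
move=> x01; rewrite DeltaE (le_trans (ler_norm_sum _ _ _)) //.
rewrite (le_trans (ler_sum _ (fun i _ => norm_indic_sub_le1 _ x01))) //.
by rewrite sumr_const_nat subn0.
Qed.

(* For [u = 1] strictness of the inequality still gives the carry correctly. *)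
Lemma ltr_natD (R : realType) (w u : R) (c xi : nat) :
  0 <= w < 1 -> 0 <= u <= 1 ->
  (c%:R + w < xi%:R + u)%R%:R = (c < xi)%:R + (c == xi)%:R * (w < u)%R%:R :> R.
Proof.
move=> /andP[w0 w1] /andP[u0 u1]; case: ltngtP => [cx|xc|->].
- have : c.+1%:R <= xi%:R :> R by rewrite ler_nat.
  rewrite -natr1 => h; rewrite (_ : _ < _ = true) ?mul0r ?addr0 //.
  by apply/idP; lra.
- have : xi.+1%:R <= c%:R :> R by rewrite ler_nat.
  rewrite -natr1 => h; rewrite (_ : _ < _ = false) ?mul0r ?addr0 //.
  by apply/negbTE; rewrite -leNgt; lra.
- by rewrite ltrD2l mul1r add0r.
Qed.

Lemma sumr_ltnl (R : realType) (b xi : nat) : (xi < b)%N ->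
  \sum_(0 <= c < b) (c < xi)%:R = xi%:R :> R.
Proof.
move=> xb; rewrite (big_cat_nat (leq0n xi) (ltnW xb)) /=.
rewrite big_nat (eq_bigr (fun=> 1)) => [|i /andP[_ ->] //].
rewrite -big_nat sumr_const_nat subn0 big_nat big1 ?addr0 // => i /andP[].
by rewrite leqNgt => /negbTE ->.
Qed.

Lemma sumr_eqn (R : realType) (b xi : nat) : (xi < b)%N ->
  \sum_(0 <= c < b) (c == xi)%:R = 1 :> R.
Proof.
move=> xb; rewrite (big_cat_nat (leq0n xi) (ltnW xb)) /= [X in _ + X]big_ltn // eqxx.
rewrite big_nat big1 ?add0r => [|i /andP[_ /ltn_eqF ->] //].
by rewrite big_nat big1 ?addr0 // => i /andP[/gtn_eqF ->].
Qed.

Lemma sumr_ltnr (R : realType) (b c : nat) : (c < b)%N ->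
  \sum_(0 <= xi < b) (c < xi)%:R = b%:R - 1 - c%:R :> R.
Proof.
move=> cb; have := sumr_ltnl R cb; have := sumr_eqn R cb.
have : \sum_(0 <= xi < b) (1 : R) = b%:R by rewrite sumr_const_nat subn0.
rewrite (eq_bigr (fun xi => (c < xi)%:R + (xi == c)%:R + (xi < c)%:R)); last first.
  by move=> i _; case: ltngtP; rewrite /= ?addr0 ?add0r.
by rewrite !big_split /= => <- -> ->; ring.
Qed.

Lemma sumr_id (R : realType) (n : nat) :
  \sum_(0 <= a < n) a%:R = n%:R * (n%:R - 1) / 2 :> R.
Proof.
elim: n => [|n IH]; first by rewrite big_nil mul0r mul0r.
by rewrite big_nat_recr //= IH -natr1; field.
Qed.

Lemma sumr_sqr (R : realType) (n : nat) :
  \sum_(0 <= a < n) a%:R ^+ 2 = n%:R * (n%:R - 1) * (2 * n%:R - 1) / 6 :> R.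
Proof.
elim: n => [|n IH]; first by rewrite big_nil !mul0r.
by rewrite big_nat_recr //= IH -natr1; field.
Qed.

Lemma sum_nat_mul (V : nmodType) (m n : nat) (F : nat -> V) :
  \sum_(0 <= i < m * n) F i =
  \sum_(0 <= i < m) \sum_(0 <= j < n) F (i * n + j)%N.
Proof.
rewrite big_nat_mul; apply: eq_bigr => i _.
by rewrite -{1}[(i * n)%N]add0n big_addn mulSn addnK; under eq_bigr do rewrite addnC.
Qed.

Lemma vdc_ltE (R : realType) (b N a xi : nat) (u : R) :
  (1 < b)%N -> (a < b)%N -> 0 <= u <= 1 ->
  (vdc R b (b * N + a) < (xi%:R + u) / b%:R)%R%:R =
  (a < xi)%:R + (a == xi)%:R * (vdc R b N < u)%R%:R :> R.
Proof.
move=> b1 ab u01; rewrite vdcS // ltr_pM2r ?invr_gt0 ?ltr0n ?(ltnW b1) //.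
exact: ltr_natD (vdc_itv _ _ b1) u01.
Qed.

(** In a complete run of [b] indices with the same higher digits, [xi] lowest digits win outright
    and the digit [xi] leaves the decision to [u], so each run reproduces one term of [Delta b N u].
    Only the last, incomplete run of [a] indices leaves a correction. *)
Lemma Delta_rec (R : realType) (b N a xi : nat) (u : R) :
  (1 < b)%N -> (a < b)%N -> (xi < b)%N -> 0 <= u <= 1 ->
  Delta b (b * N + a) ((xi%:R + u) / b%:R) = Delta b N u +
  \sum_(0 <= c < a) ((c < xi)%:R + (c == xi)%:R * (vdc R b N < u)%R%:R
                     - (xi%:R + u) / b%:R).
Proof.
move=> b1 ab xib u01.
have bN0 : b%:R != 0 :> R by rewrite pnatr_eq0 -lt0n ltnW.
have a_itv c : (c < a)%N -> (c < b)%N by move=> ca; exact: ltn_trans ca ab.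
rewrite DeltaE (big_cat_nat (leq0n (b * N)) (leq_addr _ _)) /=; congr (_ + _).
  rewrite mulnC sum_nat_mul DeltaE; apply: eq_bigr => n _.
  under eq_big_nat => c /andP[_ cb] do rewrite mulnC vdc_ltE //.
  rewrite sumrB big_split /= sumr_ltnl // -mulr_suml sumr_eqn // mul1r.
  by rewrite sumr_const_nat subn0 -[X in _ - X]mulr_natr divfK // opprD addrACA subrr add0r.
rewrite -{1}[(b * N)%N]add0n big_addn addKn; apply: eq_big_nat => c /andP[_ ca].
by rewrite addnC vdc_ltE // a_itv.
Qed.

(* The average of [Delta b N] and [Delta b N.+1]; unlike [Delta b N] itself it
   becomes a martingale along the digits once [vdc_mean] is subtracted. *)
Definition Delta_mid (R : realType) (b N : nat) (x : R) : R :=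
  Delta b N x + ((vdc R b N < x)%R%:R - x) / 2.

(** * Mean and size of the increments *)

Definition vdc_mean (R : realType) (b : nat) : R :=
  (b%:R ^+ 2 - 1) / (12 * b%:R).

Definition mid_incr (R : realType) (b N a xi : nat) (u : R) : R :=
  Delta_mid b (b * N + a) ((xi%:R + u) / b%:R) - Delta_mid b N u - vdc_mean R b.

Lemma mid_incrE (R : realType) (b N a xi : nat) (u : R) :
  (1 < b)%N -> (a < b)%N -> (xi < b)%N -> 0 <= u <= 1 ->
  let e c := (c < xi)%:R + (c == xi)%:R * (vdc R b N < u)%R%:R
             - (xi%:R + u) / b%:R in
  mid_incr b N a xi u = \sum_(0 <= c < a) e c
    + (e a - ((vdc R b N < u)%R%:R - u)) / 2 - vdc_mean R b.
Proof.
move=> b1 ab xib u01 e; have bN0 : b%:R != 0 :> R by rewrite pnatr_eq0 -lt0n ltnW.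
rewrite /mid_incr /Delta_mid Delta_rec // vdc_ltE // -/(e a).
set S := \sum_(_ <= c < _) _; set m := vdc_mean _ _.
by congr (_ - _); move: (e a : R) (S : R) => ea {}S; field.
Qed.

(** After summation over [xi], the correction sum carries [a * d] and the half term
    [(1 - b) * d / 2]. Over all [a] these cancel, which explains the weight one half in [Delta_mid].
    The rest is free of [N] and [u] and equals [b ^ 2] times [vdc_mean]. *)
Lemma sum_mid_incr (R : realType) (b N : nat) (u : R) :
  (1 < b)%N -> 0 <= u <= 1 ->
  \sum_(0 <= a < b) \sum_(0 <= xi < b) mid_incr b N a xi u = 0.
Proof.
move=> b1 u01; have bN0 : b%:R != 0 :> R by rewrite pnatr_eq0 -lt0n ltnW.
set eps : R := (vdc R b N < u)%R%:R; set d := eps - u.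
pose e c xi : R := (c < xi)%:R + (c == xi)%:R * eps - (xi%:R + u) / b%:R.
have cst_sum n (x : R) : \sum_(0 <= xi < n) x = n%:R * x.
  by rewrite sumr_const_nat subn0 mulr_natl.
have rowE c : (c < b)%N -> \sum_(0 <= xi < b) e c xi = (b%:R - 1) / 2 - c%:R + d.
  move=> cb; rewrite sumrB big_split /= sumr_ltnr // -mulr_suml.
  under [X in _ + X * _]eq_bigr do rewrite eq_sym.
  by rewrite sumr_eqn // -mulr_suml big_split /= sumr_id cst_sum /d; field.
have rowsE a : (a < b)%N ->
    \sum_(0 <= xi < b) mid_incr b N a xi u =
    a%:R * (b%:R / 2 + d) - a%:R ^+ 2 / 2
    + ((b%:R - 1) / 2 - a%:R + (1 - b%:R) * d) / 2 - b%:R * vdc_mean R b.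
  move=> ab; under eq_big_nat => xi /andP[_ xib] do rewrite mid_incrE //.
  rewrite big_split /= sumrN cst_sum big_split /= -mulr_suml sumrB rowE // cst_sum.
  rewrite -/eps -/d exchange_big /=.
  under eq_big_nat => c /andP[_ ca] do rewrite rowE ?(ltn_trans ca ab) //.
  have -> : \sum_(0 <= c < a) ((b%:R - 1) / 2 - c%:R + d) =
     a%:R * (b%:R / 2 + d) - a%:R ^+ 2 / 2 :> R.
    by rewrite big_split /= big_split /= sumrN sumr_id !cst_sum; field.
  by field.
rewrite (eq_big_nat _ _ (fun a ab => rowsE a (elimTF andP ab).2)).
rewrite big_split /= cst_sum; rewrite big_split /= sumrB -!mulr_suml sumr_id sumr_sqr.
rewrite big_split /= cst_sum sumrB cst_sum sumr_id /vdc_mean; by field.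
Qed.

Lemma vdc_mean_itv (R : realType) (b : nat) : (1 < b)%N ->
  0 <= vdc_mean R b <= b%:R / 12.
Proof.
move=> b1; have b2 : 2 <= b%:R :> R by rewrite ler_nat.
have b0 : 0 < b%:R :> R by lra.
rewrite /vdc_mean divr_ge0 ?ler_pdivrMr /=; [nra | lra | nra | lra].
Qed.

(** There are at most [b - 1] correction terms of size at most 1, half a difference of two more such
    terms, and a mean of at most [b / 12]. *)
Lemma norm_mid_incr (R : realType) (b N a xi : nat) (u : R) :
  (1 < b)%N -> (a < b)%N -> (xi < b)%N -> 0 <= u <= 1 ->
  `|mid_incr b N a xi u| <= 2 * b%:R.
Proof.
move=> b1 ab xib u01; rewrite mid_incrE //; set eps := (vdc R b N < u)%R.
have b2 : 2 <= b%:R :> R by rewrite ler_nat.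
have b0 : 0 < b%:R :> R by lra.
have x01 : 0 <= (xi%:R + u) / b%:R <= 1.
  have : xi.+1%:R <= b%:R :> R by rewrite ler_nat.
  move: u01 => /andP[u0 u1]; rewrite -natr1 => xib'.
  rewrite divr_ge0 ?(ltW b0) ?addr_ge0 //= ler_pdivrMr // mul1r; lra.
have e1 c : `|(c < xi)%:R + (c == xi)%:R * eps%:R - (xi%:R + u) / b%:R| <= 1.
  have -> : (c < xi)%:R + (c == xi)%:R * eps%:R
      = ((c < xi)%N || (c == xi) && eps)%:R :> R.
    by rewrite -natrM mulnb; case: ltngtP; rewrite /= ?addr0 ?add0r.
  exact: norm_indic_sub_le1.
set S := \sum_(0 <= c < a) _.
have hS : `|S| <= a%:R.
  rewrite (le_trans (ler_norm_sum _ _ _)) // (le_trans (ler_sum _ (fun i _ => e1 i))) //.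
  by rewrite sumr_const_nat subn0.
have /andP[m0 m1] := vdc_mean_itv R b1.
have := e1 a; have := norm_indic_sub_le1 eps u01.
have : a.+1%:R <= b%:R :> R by rewrite ler_nat.
move: hS; rewrite -natr1 !ler_norml => /andP[? ?] ? /andP[? ?] /andP[? ?].
by apply/andP; split; lra.
Qed.

(** * Exponential moments *)

(** From [expR (- y) >= 1 - y] comes [expR y <= (1 - y)^-1]; the rest is
    [y ^ 2 * (1 - 2 * y) >= 0]. *)
Lemma expR_le_quadratic (R : realType) (y : R) :
  y <= 2^-1 -> expR y <= 1 + y + 2 * y ^+ 2.
Proof.
move=> y2; have h : 0 < 1 - y by lra.
rewrite -[y in expR y]opprK expRN.
rewrite (@le_trans _ _ (1 - y)^-1) ?lef_pV2 ?posrE ?expR_gt0 ?expR_ge1Dx //.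
rewrite -[leLHS]mul1r ler_pdivrMr //.
have : 0 <= y ^+ 2 * (1 - 2 * y) by rewrite mulr_ge0 ?sqr_ge0 //; lra.
lra.
Qed.

(** One step of an Azuma-Hoeffding argument: the linear terms sum to zero, and the quadratic ones
    cost a factor [expR (2 * c ^+ 2)]. *)
Lemma sum_expR_le (R : realType) (m n : nat) (c : R) (F : nat -> nat -> R) :
  c <= 2^-1 ->
  (forall i j, (i < m)%N -> (j < n)%N -> `|F i j| <= c) ->
  \sum_(0 <= i < m) \sum_(0 <= j < n) F i j = 0 ->
  \sum_(0 <= i < m) \sum_(0 <= j < n) expR (F i j)
    <= m%:R * n%:R * expR (2 * c ^+ 2).
Proof.
move=> c2 Fc F0.
have bnd i j : (i < m)%N -> (j < n)%N -> expR (F i j) <= F i j + expR (2 * c ^+ 2).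
  move=> im jn; have Fij := Fc i j im jn.
  have F2 : F i j <= 2^-1 by rewrite (le_trans (ler_norm _)) // (le_trans Fij).
  rewrite (le_trans (expR_le_quadratic F2)) // addrAC addrC lerD2l.
  rewrite (le_trans _ (expR_ge1Dx _)) // lerD2l ler_pM2l // -real_normK ?num_real //.
  by rewrite lerXn2r ?nnegrE // (le_trans (normr_ge0 _) Fij).
apply: (@le_trans _ _ (\sum_(0 <= i < m) \sum_(0 <= j < n) (F i j + expR (2 * c ^+ 2)))).
  apply: ler_sum_nat => i /andP[_ im]; apply: ler_sum_nat => j /andP[_ jn].
  exact: bnd.
under eq_bigr do rewrite big_split /= sumr_const_nat subn0.
by rewrite big_split /= F0 add0r sumr_const_nat subn0 -mulrnA -natrM [leRHS]mulr_natl mulnC.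
Qed.

(** Unnormalised exponential moment over the integers with leading digit [d] and [k] free digits.
    The grid has [b ^ k.+1] cells, enough to resolve all [k + 1] digits, and is sampled at right
    endpoints. *)
Definition mid_moment (R : realType) (b d k : nat) (t : R) : R :=
  \sum_(0 <= j < b ^ k) \sum_(0 <= l < b ^ k.+1)
    expR (t * (Delta_mid b (d * b ^ k + j) (l.+1%:R / (b ^ k.+1)%:R)
               - k%:R * vdc_mean R b)).

Lemma grid_itv (R : realType) (n l : nat) : (l < n)%N -> 0 <= (l.+1%:R / n%:R : R) <= 1.
Proof.
move=> ln; rewrite divr_ge0 //= ler_pdivrMr ?mul1r ?ler_nat //.
by rewrite ltr0n (leq_ltn_trans _ ln).
Qed.

Lemma mid_momentS (R : realType) (b d k : nat) (t : R) :
  (1 < b)%N -> `|t| * (2 * b%:R) <= 2^-1 ->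
  mid_moment b d k.+1 t <=
  b%:R ^+ 2 * expR (2 * (`|t| * (2 * b%:R)) ^+ 2) * mid_moment b d k t.
Proof.
move=> b1 t2; have bN0 : b%:R != 0 :> R by rewrite pnatr_eq0 -lt0n ltnW.
(* The new digit [a] of [j] is its lowest, the new digit [xi] of [l] its highest. With the old
   digits fixed, the factor [Y] comes out and the one-step bound applies to the pair. *)
rewrite /mid_moment [in leLHS]expnSr sum_nat_mul mulr_sumr.
apply: ler_sum_nat => j _.
under eq_bigr do rewrite -expnSr expnS sum_nat_mul.
under eq_bigr do rewrite exchange_big.
rewrite exchange_big mulr_sumr /=; apply: ler_sum_nat => l /andP[_ lb].
set N := (d * b ^ k + j)%N; set u : R := l.+1%:R / _.
have u01 : 0 <= u <= 1 by exact: grid_itv.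
set Y := expR (t * (Delta_mid b N u - _)).
have expE a xi : expR (t * (Delta_mid b (d * b ^ k.+1 + (j * b + a))
      ((xi * b ^ k.+1 + l).+1%:R / (b * b ^ k.+1)%:R) - k.+1%:R * vdc_mean R b)) =
    Y * expR (t * mid_incr b N a xi u).
  rewrite -expRD; congr expR.
  have -> : (d * b ^ k.+1 + (j * b + a) = b * N + a)%N by rewrite /N expnS; lia.
  have -> : (xi * b ^ k.+1 + l).+1%:R / (b * b ^ k.+1)%:R = (xi%:R + u) / b%:R :> R.
    rewrite -addnS natrD !natrM /u; field.
    by rewrite bN0 natrX expf_neq0.
  by rewrite /mid_incr -natr1; ring.
under eq_bigr do (under eq_bigr do rewrite expE; rewrite -mulr_sumr).
rewrite -mulr_sumr mulrC ler_wpM2r ?expR_ge0 // expr2; apply: sum_expR_le => //.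
- by move=> a xi ab xib; rewrite normrM ler_wpM2l // norm_mid_incr.
- under eq_bigr do rewrite -mulr_sumr.
  by rewrite -mulr_sumr sum_mid_incr // mulr0.
Qed.

Lemma norm_mid_sub_Delta (R : realType) (b N : nat) (x : R) : 0 <= x <= 1 ->
  `|Delta_mid b N x - Delta b N x| <= 2^-1.
Proof.
move=> x01; rewrite /Delta_mid addrAC subrr add0r normrM [`|2^-1|]ger0_norm //.
by rewrite -[leRHS]mul1r ler_wpM2r // norm_indic_sub_le1.
Qed.

Lemma mid_moment_le (R : realType) (b d k : nat) (t : R) :
  (1 < b)%N -> (d < b)%N -> `|t| * (2 * b%:R) <= 2^-1 ->
  mid_moment b d k t <=
  (b ^ k)%:R * (b ^ k.+1)%:R *
    expR (2^-1 + k%:R * (2 * (`|t| * (2 * b%:R)) ^+ 2)).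
Proof.
move=> b1 db t2; set E := 2 * _.
elim: k => [|k IH]; last first.
  rewrite (le_trans (mid_momentS d k b1 t2)) // -/E.
  rewrite (le_trans (ler_wpM2l _ IH)) ?mulr_ge0 ?sqr_ge0 ?expR_ge0 //.
  rewrite -[k.+1%:R]natr1 mulrDl mul1r addrA [in leRHS]expRD !natrX !exprS.
  by rewrite le_eqVlt; apply/orP; left; apply/eqP; ring.
(* With no free digit, [N = d] and [Delta_mid] is at most [d + 1/2 <= 2 * b], so the exponent is at
   most [2^-1], the constant term of the bound. *)
rewrite /mid_moment expn0 expn1 big_nat1 !mul0r addr0 mul1r.
rewrite (le_trans (y := \sum_(0 <= l < b) expR 2^-1)) //; last first.
  by rewrite sumr_const_nat subn0 mulr_natl.
apply: ler_sum_nat => l /andP[_ lb]; rewrite ler_expR subr0 muln1 addn0.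
have x01 := grid_itv R lb; set x := _ / _.
rewrite (le_trans (ler_norm _)) // (le_trans _ t2) // normrM ler_wpM2l //.
have := norm_mid_sub_Delta b d x01; have := norm_Delta_le b d x01.
have : d.+1%:R <= b%:R :> R by rewrite ler_nat.
have : 2 <= b%:R :> R by rewrite ler_nat.
rewrite -/x -[d.+1%:R]natr1 !ler_norml => ? ? /andP[? ?] /andP[? ?].
by apply/andP; split; lra.
Qed.

(** * Integrals over cells and the [L_p] distance to a constant *)

Lemma measurable_Delta (R : realType) (b N : nat) :
  measurable_fun [set: R] (Delta b N : R -> R).
Proof.
rewrite (_ : Delta b N = fun x => \sum_(n <- index_iota 0 N)
    (\1_`]vdc R b n, +oo[ x - x)); last first.
  apply/funext => x; rewrite DeltaE; apply: eq_bigr => n _.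
  by rewrite indicE mem_setE in_itv /= andbT.
apply: measurable_sum => n; apply: measurable_funB => //.
Qed.

Lemma integral_step_le (R : realType) (n : nat) (g : R -> R) (c : nat -> R) :
  (0 < n)%N -> measurable_fun [set: R] g -> (forall x, 0 <= g x) ->
  (forall l x, (l < n)%N -> l%:R / n%:R < x <= l.+1%:R / n%:R -> g x <= c l) ->
  (\int[lebesgue_measure]_(x in `[0%R, 1%R]) (g x)%:E
     <= (n%:R^-1 * \sum_(0 <= l < n) c l)%:E)%E.
Proof.
move=> n0 mg g0 gc; have nN0 : 0 < n%:R :> R by rewrite ltr0n.
have mgE D : measurable_fun D (fun x => (g x)%:E) by apply/measurable_EFinP; exact: measurable_funTS.
(* The half-open cells fill []0, 1]]; the missing point [0] has measure zero. *)
suff H m : (m <= n)%N ->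
    (\int[lebesgue_measure]_(x in `]0%R, (m%:R / n%:R)%R]) (g x)%:E
     <= (n%:R^-1 * \sum_(0 <= l < m) c l)%:E)%E.
  by have := H n (leqnn n); rewrite divff ?gt_eqF // integral_itv_obnd_cbnd.
elim: m => [_|m IH mn].
  by rewrite mul0r set_itvoc0 integral_set0 big_nil mulr0.
rewrite (@itv_bndbnd_setU _ _ _ (BRight (m%:R / n%:R))); last 2 first.
  by rewrite bnd_simp divr_ge0.
  by rewrite bnd_simp ler_pM2r ?invr_gt0 // ler_nat.
rewrite ge0_integral_setU //=; last 3 first.
  exact: mgE.
  by move=> x _; rewrite lee_fin.
  apply/disj_setPS => x [] /=.
  by rewrite !in_itv /= => /andP[_ xm] /andP[mx _]; move: (lt_le_trans mx xm); rewrite ltxx.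
rewrite big_nat_recr //= mulrDr EFinD leeD ?IH ?(ltnW mn) //.
apply: (@le_trans _ _ (\int[lebesgue_measure]_(x in `](m%:R / n%:R)%R, (m.+1%:R / n%:R)%R])
    cst (c m)%:E x)%E).
  apply: ge0_le_integral => //=; [by move=> x _; rewrite lee_fin | exact: mgE |].
  by move=> x; rewrite /= in_itv /= lee_fin; exact: gc.
rewrite integral_cst //= lebesgue_measure_itv /= lte_fin ltr_pM2r ?invr_gt0 //.
rewrite ltr_nat ltnSn -EFinB -EFinM -mulrBl -natrB // subSnn mul1r.
by rewrite mulrC.
Qed.

(** Minkowski's inequality is applied on the whole line, so functions on [D] are extended by zero;
    [p != 0] makes the [p]-th power of zero vanish. *)
Lemma Lnorm_restrict (R : realType) (p : R) (D : set R) (f : R -> R) : p != 0 ->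
  ('N[@lebesgue_measure R]_p%:E[EFin \o (f \_ D)] =
  (\int[lebesgue_measure]_(x in D) (`|f x| `^ p)%:E) `^ p^-1)%E.
Proof.
move=> p0; rewrite unlock; congr poweR; rewrite [RHS]integral_mkcond.
apply: eq_integral => x _ /=; rewrite !patchE; case: ifPn => //= _.
by rewrite normr0 powR0.
Qed.

(** The unit interval has measure 1, so the constant [m] has norm [m], and Minkowski's inequality
    compares it with the norm of [f] in both directions. *)
Lemma Lp_dist_cst (R : realType) (p m s : R) (f : R -> R) :
  1 <= p -> 0 <= m -> 0 <= s -> measurable_fun [set: R] f ->
  (\int[lebesgue_measure]_(x in `[0%R, 1%R]) (`|f x - m| `^ p)%:E <= (s `^ p)%:E)%E ->
  `|(\int[lebesgue_measure]_(x in `[0, 1]) (`|f x| `^ p)) `^ p^-1 - m| <= s.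
Proof.
move=> p1 m0 s0 mf fs; have p0 : 0 < p by lra.
set D := [set` `[0%R, 1%R]] in fs *.
have mD : measurable D by exact: measurable_itv.
have mr (h : R -> R) : measurable_fun [set: R] h -> measurable_fun [set: R] (h \_ D).
  by move=> mh; apply/(measurable_restrictT h mD); exact: measurable_funTS.
have mfm : measurable_fun [set: R] (fun x => f x - m) by exact: measurable_funB.
pose L := Lnorm (@lebesgue_measure R) p%:E.
have Lm : L (EFin \o (cst m \_ D)) = m%:E.
  rewrite /L Lnorm_restrict ?gt_eqF // -/(cst (`|m| `^ p)%:E) integral_cst //.
  rewrite /D /= lebesgue_measure_itv /= lte_fin ltr01 oppr0 adde0 mule1 poweR_EFin.
  by rewrite -powRrM divff ?gt_eqF // powRr1 ?normr_ge0 // ger0_norm.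
have Lg : (L (EFin \o ((fun x => f x - m)%R \_ D)) <= s%:E)%E.
  rewrite /L Lnorm_restrict ?gt_eqF //.
  have -> : s%:E = ((s `^ p)%:E `^ p^-1)%E.
    by rewrite poweR_EFin -powRrM divff ?gt_eqF // powRr1.
  apply: gt0_ler_poweR => //; first by rewrite invr_ge0 ltW.
    rewrite in_itv /= leey andbT; apply: integral_ge0 => x _.
    by rewrite lee_fin powR_ge0.
  by rewrite in_itv /= leey andbT lee_fin powR_ge0.
have fE : f \_ D = (((fun x => f x - m) \_ D) \+ (cst m \_ D))%R.
  by apply/funext => x /=; rewrite !patchE; case: ifPn => _; rewrite ?subrK ?addr0.
have mc : measurable_fun [set: R] (cst m : R -> R) by exact: measurable_cst.
have up : (L (EFin \o (f \_ D)) <= (s + m)%:E)%E.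
  have := minkowski_EFin (@lebesgue_measure R) (mr _ mfm) (mr _ mc) p1.
  rewrite -fE => /le_trans; apply.
  by rewrite -/(L _) -/(L _) Lm EFinD leeD2r.
have lo : (m%:E <= L (EFin \o (f \_ D)) + s%:E)%E.
  have := lerB_DLnorm (@lebesgue_measure R) (mr _ mc) (mr _ mfm) p1.
  rewrite (_ : (_ \+ _)%R = f \_ D); last by rewrite fE; apply/funext => x /=; rewrite addrC.
  rewrite -!/(L _) Lm => /le_trans; apply.
  by rewrite leeD2l.
move: up lo; rewrite /L Lnorm_restrict ?gt_eqF //.
rewrite -/(L _) /Rintegral.
set I := (\int[_]_(_ in _) _)%E => up lo.
have I0 : (0 <= I)%E by rewrite integral_ge0 // => x _; rewrite lee_fin powR_ge0.
(* [fine] would send an infinite integral to 0; the upper bound just obtained excludes this. *)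
have If : I \is a fin_num.
  rewrite ge0_fin_numE // ltNge leye_eq; apply/eqP => Iy.
  by move: up; rewrite Iy poweRyr ?invr_eq0 ?gt_eqF // leye_eq.
move: up lo; rewrite -(fineK If) poweR_EFin -EFinD !lee_fin => up lo.
by rewrite ler_norml; apply/andP; split; lra.
Qed.

(** * From grid points to the whole unit interval *)

Lemma vdc_ltr_grid (R : realType) (b K n l : nat) (x : R) :
  (1 < b)%N -> (n < b ^ K)%N ->
  l%:R / (b ^ K)%:R < x <= l.+1%:R / (b ^ K)%:R ->
  (vdc R b n < x) = (vdc R b n < l.+1%:R / (b ^ K)%:R).
Proof.
move=> b1 nK /andP[lx xl].
have B0 : 0 < (b ^ K)%:R^-1 :> R by rewrite invr_gt0 ltr0n expn_gt0 ltnW.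
have [c _ E] := vdc_grid R b1 nK; rewrite E -natrX ltr_pM2r // ltr_nat ltnS.
have [cl|lc] := leqP c l.
  by apply: le_lt_trans lx; rewrite ler_pM2r // ler_nat.
apply/negbTE; rewrite -leNgt; apply: le_trans xl _.
by rewrite ler_pM2r // ler_nat.
Qed.

(** The indicators are constant on a cell, so only the linear part moves, by at most [N / b ^ K]. *)
Lemma Delta_grid (R : realType) (b K N l : nat) (x : R) :
  (1 < b)%N -> (N <= b ^ K)%N ->
  l%:R / (b ^ K)%:R < x <= l.+1%:R / (b ^ K)%:R ->
  `|Delta b N x - Delta b N (l.+1%:R / (b ^ K)%:R)| <= 1.
Proof.
move=> b1 NK lxl; have B0 : 0 < (b ^ K)%:R :> R by rewrite ltr0n expn_gt0 ltnW.
set x' := l.+1%:R / _.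
rewrite !DeltaE -sumrB (eq_big_nat _ _ (F2 := fun=> x' - x)); last first.
  move=> n /andP[_ nN]; rewrite (vdc_ltr_grid b1 (leq_trans nN NK) lxl) -/x'.
  by rewrite opprB addrC addrA subrK.
move: lxl => /andP[lx xl]; rewrite sumr_const_nat subn0 ger0_norm; last first.
  by rewrite mulrn_wge0 // subr_ge0.
have hx : x' - x <= (b ^ K)%:R^-1.
  by rewrite lerBlDr /x' -natr1 mulrDl mul1r addrC lerD2l ltW.
rewrite -mulr_natr (le_trans (ler_wpM2r _ hx)) // mulrC ler_pdivrMr // mul1r.
by rewrite ler_nat.
Qed.

(** If [y <= T / 2], the first term suffices because [p >= 1]. Otherwise [z <= expR z] at
    [z = y / (2 * p)] gives a bound by [expR (y / 2)], and [y / 2 <= y - T / 4]. Half of the [p]-th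
    power of [T] stays available for the exponential term. *)
Lemma powR_le_expR (R : realType) (p T y : R) :
  1 <= p -> 1 <= T -> 0 <= y ->
  y `^ p <= T `^ p / 2 + (2 * p) `^ p * expR (- (T / 4)) * expR y.
Proof.
move=> p1 T1 y0; have p0 : 0 < p by lra.
have [yT|yT] := leP y (T / 2).
  rewrite (@le_trans _ _ (T `^ p / 2)) //; last first.
    by rewrite lerDl !mulr_ge0 ?powR_ge0 ?expR_ge0.
  rewrite (@le_trans _ _ ((T / 2) `^ p)) //.
    by rewrite ge0_ler_powR ?nnegrE //; lra.
  rewrite powRM ?invr_ge0 //; last lra.
  rewrite ler_wpM2l ?powR_ge0 // ge1r_powR //; lra.
have y_gt0 : 0 < y by lra.
rewrite (@le_trans _ _ ((2 * p) `^ p * expR (y / 2))) //; last first.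
  rewrite -mulrA -expRD (@le_trans _ _ ((2 * p) `^ p * expR (- (T / 4) + y))) //.
    by rewrite ler_wpM2l ?powR_ge0 // ler_expR; lra.
  by rewrite lerDr divr_ge0 ?powR_ge0.
have -> : expR (y / 2) = (expR (y / (2 * p))) `^ p.
  by rewrite -expRM; congr expR; field; lra.
rewrite -powRM ?expR_ge0; [| lra..].
apply: ge0_ler_powR; rewrite ?nnegrE ?mulr_ge0 ?expR_ge0 //; [lra..|].
have -> : y = 2 * p * (y / (2 * p)) by field; lra.
set z := y / _ in |- *.
rewrite [2 * p * z / _](_ : _ = z); last by field; lra.
rewrite ler_pM2l; last lra.
by rewrite (le_trans _ (expR_ge1Dx _)) // lerDr.
Qed.

(** * Concentration of the norm for a single [N] *)

Lemma logb_itv (R : realType) (b k N : nat) : (1 < b)%N ->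
  (b ^ k <= N < b ^ k.+1)%N -> k%:R <= logb R b N <= k%:R + 1.
Proof.
move=> b1 /andP[kN Nk].
have b1R : 1 < b%:R :> R by rewrite ltr1n.
have lnb : 0 < ln b%:R :> R by rewrite ln_gt0.
have bk0 : (0 < b ^ k)%N by rewrite expn_gt0 ltnW.
rewrite /logb ler_pdivlMr // ler_pdivrMr // natr1 !mulr_natl -!lnXn ?(lt_trans ltr01) //.
by rewrite -!natrX !ler_ln ?posrE ?ltr0n ?expn_gt0 ?(ltnW b1) ?(leq_trans bk0) // !ler_nat kN ltnW.
Qed.

Lemma leading_digit_itv (b d k j : nat) :
  (0 < d < b)%N -> (j < b ^ k)%N -> (b ^ k <= d * b ^ k + j < b ^ k.+1)%N.
Proof.
move=> /andP[d0 db] jk.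
apply/andP; split; first by rewrite (leq_trans _ (leq_addr _ _)) // leq_pmull.
rewrite expnS (leq_trans (n := d.+1 * b ^ k)) ?leq_mul2r ?db ?orbT //.
by rewrite mulSn addnC ltn_add2r.
Qed.

(** Both signs of [t] occur so that each summand dominates [expR |t * Y|], with [Y] the centred
    [Delta_mid]. *)
Definition mid_weight (R : realType) (b k : nat) (t : R) (N : nat) : R :=
  (b ^ k.+1)%:R^-1 * \sum_(0 <= l < b ^ k.+1)
    (expR (t * (Delta_mid b N (l.+1%:R / (b ^ k.+1)%:R) - k%:R * vdc_mean R b)) +
     expR (- t * (Delta_mid b N (l.+1%:R / (b ^ k.+1)%:R) - k%:R * vdc_mean R b))).

Lemma sum_mid_weight_le (R : realType) (b d k : nat) (t : R) :
  (1 < b)%N -> (d < b)%N -> `|t| * (2 * b%:R) <= 2^-1 ->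
  \sum_(0 <= j < b ^ k) mid_weight b k t (d * b ^ k + j) <=
  2 * (b ^ k)%:R * expR (2^-1 + k%:R * (2 * (`|t| * (2 * b%:R)) ^+ 2)).
Proof.
move=> b1 db t2; have B0 : 0 < (b ^ k.+1)%:R :> R by rewrite ltr0n expn_gt0 ltnW.
rewrite -mulr_sumr ler_pdivrMl //.
under eq_bigr do rewrite big_split.
rewrite big_split /=.
have t2N : `|- t| * (2 * b%:R) <= 2^-1 by rewrite normrN.
have := lerD (mid_moment_le k b1 db t2) (mid_moment_le k b1 db t2N).
rewrite normrN => /le_trans; apply.
by rewrite le_eqVlt; apply/orP; left; apply/eqP; ring.
Qed.

Lemma mid_weight_concentration (R : realType) (p T t : R) (b d k j : nat) :
  1 <= p -> 1 <= T -> (1 < b)%N -> (0 < d < b)%N -> (0 < k)%N -> (j < b ^ k)%N ->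
  0 < t -> t * (2 * b%:R) <= 2^-1 ->
  let N := (d * b ^ k + j)%N in
  expR 1 * (2 * p) `^ p * expR (- (T / 4)) * mid_weight b k t N <= T `^ p / 2 ->
  `|normDelta b p N - vdc_mean R b * logb R b N| <= T / t.
Proof.
move=> p1 T1 b1 db k0 jk t0 tb N W.
have b2 : 2 <= b%:R :> R by rewrite ler_nat.
have /andP[mu0 mub] := vdc_mean_itv R b1.
have Nk := leading_digit_itv db jk.
have /andP[kL Lk] := logb_itv R b1 Nk.
set m := vdc_mean R b * _.
have m0 : 0 <= m by rewrite mulr_ge0 // (le_trans _ kL).
pose Y l := Delta_mid b N (l.+1%:R / (b ^ k.+1)%:R) - k%:R * vdc_mean R b.
pose C := (2 * p) `^ p * expR (- (T / 4)).
have C0 : 0 <= C by rewrite mulr_ge0 ?powR_ge0 ?expR_ge0.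
apply: Lp_dist_cst => //; [by rewrite divr_ge0 //; lra | exact: measurable_Delta |].
have tp : 0 < t `^ p by rewrite powR_gt0.
apply: le_trans (@integral_step_le _ (b ^ k.+1) _
  (fun l => (T `^ p / 2 + C * (expR 1 * (expR (t * Y l) + expR (- t * Y l)))) / t `^ p) _ _ _ _) _.
- by rewrite expn_gt0 ltnW.
- apply: (measurableT_comp (measurable_powR p)); apply: measurableT_comp;
    first exact: normr_measurable.
  by apply: measurable_funB => //; exact: measurable_Delta.
- by move=> x; rewrite powR_ge0.
- move=> l x lB lxl; set x' : R := l.+1%:R / (b ^ k.+1)%:R.
  rewrite ler_pdivlMr // -powRM ?(ltW t0) //.
  rewrite (le_trans (powR_le_expR p1 T1 _)) ?mulr_ge0 ?(ltW t0) // lerD2l -/C ler_wpM2l //.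
  (* The grid costs 1, the half term [1/2], and replacing [k] by [logb R b N] at most [b / 12]. The
     total is below [2 * b], whence the factor [expR 1]. *)
  have dist : `|Delta b N x - m| <= `|Y l| + 2 * b%:R.
    have x'01 : 0 <= x' <= 1 by exact: grid_itv.
    have := Delta_grid b1 (ltnW (proj2 (andP Nk))) lxl.
    have := norm_mid_sub_Delta b N x'01.
    have := ler_norm (Y l); have := ler_norm (- Y l); rewrite normrN.
    set y := `|Y l|; rewrite /Y -/x' => yl1 yl2.
    have mE : k%:R * vdc_mean R b <= m <= k%:R * vdc_mean R b + b%:R / 12.
      rewrite [m]mulrC ler_wpM2r //= (le_trans (ler_wpM2r mu0 Lk)) // mulrDl mul1r.
      by rewrite lerD2l.
    move: mE; rewrite !ler_norml => /andP[? ?] /andP[? ?] /andP[? ?].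
    by apply/andP; split; lra.
  rewrite (@le_trans _ _ (expR (1 + t * `|Y l|))) //.
    by rewrite ler_expR mulrC (le_trans (ler_wpM2l (ltW t0) dist)) //; lra.
  rewrite expRD ler_wpM2l ?expR_ge0 //.
  by have [_|_] := ler0P (Y l); rewrite ?mulrN -?mulNr ?lerDr ?lerDl ?expR_ge0.
rewrite lee_fin -mulr_suml mulrA powRM ?invr_ge0 ?(ltW t0) //; last lra.
rewrite -[t^-1]powR_inv1 ?(ltW t0) // -powRrM mulN1r powRN ler_wpM2r ?invr_ge0 ?(ltW tp) //.
rewrite big_split /= sumr_const_nat subn0 -mulr_sumr -mulr_sumr.
have B0 : (b ^ k.+1)%:R != 0 :> R by rewrite pnatr_eq0 -lt0n expn_gt0 ltnW.
rewrite -(mulr_natl (T `^ p / 2)) mulrDr mulKf //.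
rewrite [leRHS](splitr (T `^ p)) lerD2l (le_trans _ W) // /mid_weight -/C.
by rewrite le_eqVlt; apply/orP; left; apply/eqP; rewrite /C; ring.
Qed.

(** Single-digit [N] lie outside the blocks with [k > 0] and are treated directly: the norm is at
    most [N <= 2 * b * r] and the main term at most [b * r / 12], where [r] is the root of
    [logb R b N]. *)
Lemma small_concentration (R : realType) (p : R) (b N : nat) :
  1 <= p -> (2 <= N < b)%N ->
  `|normDelta b p N - vdc_mean R b * logb R b N| < 3 * b%:R * Num.sqrt (logb R b N).
Proof.
move=> p1 /andP[N2 Nb]; have b1 : (1 < b)%N by exact: leq_trans N2 (ltnW Nb).
have N2R : 2 <= N%:R :> R by rewrite ler_nat.
have NbR : N%:R <= b%:R :> R by rewrite ler_nat ltnW.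
have N0 : 0 < N%:R :> R by lra.
have b0 : 0 < b%:R :> R by lra.
have /andP[mu0 mub] := vdc_mean_itv R b1.
have ln_le (y : R) : 0 < y -> ln y <= y - 1.
  by move=> y0; have := @le_ln1Dx R (y - 1); rewrite (addrC 1) subrK; apply; lra.
have lnN : 2^-1 <= ln N%:R :> R.
  have Ninv : N%:R^-1 <= 2^-1 :> R by rewrite lef_pV2 ?posrE.
  have Ninv0 : 0 < N%:R^-1 :> R by rewrite invr_gt0.
  by have := ln_le _ Ninv0; rewrite lnV ?posrE //; lra.
have lnb : ln b%:R <= ln N%:R + b%:R / N%:R - 1 :> R.
  have q0 : 0 < b%:R / N%:R :> R by rewrite divr_gt0.
  have := ln_le _ q0; rewrite lnM ?posrE ?invr_gt0 // lnV ?posrE //; lra.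
have lnb0 : 0 < ln b%:R :> R by rewrite ln_gt0 // ltr1n.
set L := logb R b N.
have LE : L * ln b%:R = ln N%:R by rewrite /L /logb divfK // gt_eqF.
have L0 : 0 < L by rewrite divr_gt0 //; lra.
have L1 : L <= 1.
  by rewrite /L /logb ler_pdivrMr // mul1r ler_ln ?posrE.
set r := Num.sqrt L; have r0 : 0 < r by rewrite sqrtr_gt0.
have rE : r ^+ 2 = L by rewrite sqr_sqrtr // ltW.
have r1 : r <= 1 by rewrite -sqrtr1 ler_sqrt.
(* Squared and multiplied by [ln b], this is [N ^ 2 * ln b <= 4 * b ^ 2 * ln N], a consequence of
   [ln b <= ln N + b / N - 1] and [1 <= 2 * ln N]. *)
have Nbr : N%:R <= 2 * b%:R * r.
  rewrite -(ler_pXn2r (n := 2)) ?nnegrE ?mulr_ge0 ?(ltW b0) ?(ltW r0) ?(ltW N0) //.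
  rewrite !exprMn rE -(ler_pM2r lnb0) -[leRHS]mulrA LE.
  have h1 : N%:R ^+ 2 * ln b%:R <= N%:R ^+ 2 * ln N%:R + b%:R * N%:R :> R.
    rewrite (le_trans (ler_wpM2l (sqr_ge0 _) lnb)) // -addrA mulrDr lerD2l.
    rewrite (_ : _ * (_ - 1) = b%:R * N%:R - N%:R ^+ 2); last by field; rewrite gt_eqF.
    by rewrite gerBl sqr_ge0.
  have h2 : N%:R ^+ 2 * ln N%:R <= b%:R ^+ 2 * ln N%:R :> R.
    by rewrite ler_wpM2r ?lerXn2r ?nnegrE ?(ltW b0) ?(ltW N0) //; lra.
  have h3 : b%:R * N%:R <= b%:R ^+ 2 * (2 * ln N%:R) :> R.
    rewrite expr2 -mulrA ler_pM2l // (le_trans NbR) // -[leLHS]mulr1 ler_pM2l //; lra.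
  have h4 : 0 <= b%:R ^+ 2 * ln N%:R :> R by rewrite mulr_ge0 ?sqr_ge0 //; lra.
  by rewrite (le_trans h1) //; lra.
have normE : 0 <= normDelta b p N <= N%:R.
  (* Distance to the constant 0, with the whole unit interval as a single cell. *)
  rewrite powR_ge0 /= -[leLHS]subr0 (le_trans (ler_norm _)) //.
  apply: Lp_dist_cst => //; first exact: measurable_Delta.
  apply: le_trans (@integral_step_le _ 1 _ (fun=> N%:R `^ p) _ _ _ _) _ => //.
  - apply: (measurableT_comp (measurable_powR p)); apply: measurableT_comp;
    first exact: normr_measurable.
    by apply: measurable_funB => //; exact: measurable_Delta.
  - move=> [|//] x _; rewrite mul0r divr1 subr0 => /andP[x0 x1].
    by rewrite ge0_ler_powR ?nnegrE ?norm_Delta_le ?(ltW x0) //; lra.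
  - by rewrite big_nat1 invr1 mul1r.
have m0 : 0 <= vdc_mean R b * L by rewrite mulr_ge0 // ltW.
have m1 : vdc_mean R b * L <= b%:R * r / 12.
  rewrite -rE expr2 mulrA mulrAC -mulrA (le_trans (ler_wpM2r _ mub)) ?mulr_ge0 ?(ltW r0) //.
  have : r * r <= r by rewrite -[leRHS]mulr1 ler_pM2l.
  move=> h; rewrite mulrAC ler_pM2r // ler_pM2l //.
have br : 0 < b%:R * r by rewrite mulr_gt0.
move: normE => /andP[? ?].
by rewrite ltr_norml; apply/andP; split; lra.
Qed.

(** * Counting the exceptional [N] *)

(** With [D] the leading digit of [M], the range is enlarged to [D.+1] runs of length [b ^ k], at
    most [2 * M] integers, whence the factor 2. Runs with [d > 0] fall under the block hypothesis,
    and the initial run under induction on [k]. *)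
Lemma sum_blocks_le (R : realType) (b M : nat) (e : R) (F : nat -> R) :
  (1 < b)%N -> 0 <= e -> (0 < M)%N ->
  (forall N, 0 <= F N) -> (forall N, (N < b)%N -> F N = 0) ->
  (forall d k, (0 < d < b)%N -> (0 < k)%N ->
    \sum_(0 <= j < b ^ k) F (d * b ^ k + j)%N <= e * (b ^ k)%:R) ->
  \sum_(0 <= N < M) F N <= 2 * e * M%:R.
Proof.
move=> b1 e0 M0 F0 Fb block; have b0 := ltnW b1.
have step k D : (D < b)%N -> (0 < k)%N ->
    \sum_(0 <= N < b ^ k) F N <= e * (b ^ k)%:R ->
    \sum_(0 <= N < D.+1 * b ^ k) F N <= e * (D.+1 * b ^ k)%:R.
  move=> Db k0 IH; rewrite sum_nat_mul natrM mulrCA mulr_natl.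
  rewrite (@le_trans _ _ (\sum_(0 <= i < D.+1) (e * (b ^ k)%:R))) //; last first.
    by rewrite sumr_const_nat subn0.
  apply: ler_sum_nat => d /andP[_ dD]; case: (posnP d) => [->|d0].
    by rewrite mul0n; under eq_bigr do rewrite add0n.
  by apply: block => //; rewrite d0 (leq_ltn_trans _ Db).
have full k : \sum_(0 <= N < b ^ k.+1) F N <= e * (b ^ k.+1)%:R.
  elim: k => [|k IH].
    rewrite expn1 (eq_big_nat _ _ (F2 := fun=> 0)); last by move=> i /andP[_ /Fb].
    by rewrite big1 // mulr_ge0.
  by have := @step k.+1 b.-1; rewrite !prednK // -!expnS; apply; rewrite ?ltnSn.
have [Mb|bM] := ltnP M b.
  rewrite (eq_big_nat _ _ (F2 := fun=> 0)); last first.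
    by move=> i /andP[_ iM]; rewrite Fb // (ltn_trans iM).
  by rewrite big1 // !mulr_ge0.
set k := trunc_log b M; have /andP[kM Mk] := trunc_log_bounds b1 M0.
have k0 : (0 < k)%N.
  by case: (posnP k) => // kE; move: Mk; rewrite -/k kE expn1 ltnNge bM.
have bk0 : (0 < b ^ k)%N by rewrite expn_gt0 b0.
set D := (M %/ b ^ k)%N.
have Db : (D < b)%N by rewrite ltn_divLR // -expnS.
have D0 : (0 < D)%N by rewrite divn_gt0.
have MD : (M <= D.+1 * b ^ k)%N by rewrite ltnW // ltn_ceil.
have DM : (D.+1 * b ^ k <= 2 * M)%N.
  rewrite (leq_trans (n := 2 * D * b ^ k)) //; first by rewrite leq_mul2r; lia.
  by rewrite -mulnA leq_mul2l leq_trunc_div.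
rewrite (@le_trans _ _ (\sum_(0 <= N < D.+1 * b ^ k) F N)) //.
  by rewrite [leRHS](big_cat_nat (leq0n M) MD) lerDl sumr_ge0.
rewrite (le_trans (step k D Db k0 _)) //; first by rewrite -(prednK k0) full.
by rewrite -mulrA mulrCA ler_wpM2l // -natrM ler_nat.
Qed.

(** Markov's inequality: each exceptional [N] forces a lower bound on [mid_weight], whose sum over
    the block is bounded above. *)
Lemma block_concentration (R : realType) (p T : R) (b d k : nat) (bad : pred nat) :
  1 <= p -> 1 <= T -> (1 < b)%N -> (0 < d < b)%N -> (0 < k)%N ->
  (forall N, bad N -> 8 * T * b%:R * Num.sqrt (logb R b N)
     <= `|normDelta b p N - vdc_mean R b * logb R b N|) ->
  \sum_(0 <= j < b ^ k) (bad (d * b ^ k + j)%N)%:R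
    <= 4 * expR 1 ^+ 2 * (2 * p) `^ p * expR (- (T / 4)) * (b ^ k)%:R.
Proof.
move=> p1 T1 b1 db k0 badP; set C := (2 * p) `^ p; set X := expR (- _).
have b0 : 0 < b%:R :> R by rewrite ltr0n ltnW.
have kR : 1 <= k%:R :> R by rewrite ler1n.
set r : R := Num.sqrt k%:R; have r1 : 1 <= r by rewrite -sqrtr1 ler_sqrt.
have rE : r ^+ 2 = k%:R by rewrite sqr_sqrtr.
have r0 : 0 < r by lra.
(* This scale makes the exponent in [sum_mid_weight_le] equal to 1 and gives
   [T / t = 4 * T * b * r], strictly below the threshold with constant 8. *)
pose t := (4 * b%:R * r)^-1.
have t0 : 0 < t by rewrite invr_gt0 !mulr_gt0.
have tbE : t * (2 * b%:R) = (2 * r)^-1 by rewrite /t; field; rewrite !gt_eqF.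
have tb : t * (2 * b%:R) <= 2^-1 by rewrite tbE lef_pV2 ?posrE //; lra.
have C0 : 0 <= C by exact: powR_ge0.
have X0 : 0 <= X by exact: expR_ge0.
have badW j : (j < b ^ k)%N -> (bad (d * b ^ k + j)%N)%:R <=
    2 * expR 1 * C * X * mid_weight b k t (d * b ^ k + j).
  move=> jk; set N := (_ + j)%N; have W0 : 0 <= mid_weight b k t N.
    by rewrite mulr_ge0 ?invr_ge0 // sumr_ge0 // => i _; rewrite addr_ge0 ?expR_ge0.
  case: (boolP (bad N)) => [/badP|_]; last first.
    by apply: mulr_ge0 => //; rewrite !mulr_ge0 ?expR_ge0.
  apply: contraTT; rewrite -!ltNge => WN.
  have Tp : 1 <= T `^ p by rewrite -(powRr0 T) ler_powR //; lra.
  have := mid_weight_concentration p1 T1 b1 db k0 jk t0 tb.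
  have {}WN : expR 1 * C * X * mid_weight b k t N <= T `^ p / 2.
    by have {}WN : 2 * expR 1 * C * X * mid_weight b k t N < 1 := WN; lra.
  move=> /(_ WN) /le_lt_trans; apply.
  have /andP[kL _] := logb_itv R b1 (leading_digit_itv db jk).
  rewrite /t invrK (@lt_le_trans _ _ (8 * T * b%:R * r)) //.
    have : 0 < T * (b%:R * r) by rewrite !mulr_gt0 //; lra.
    lra.
  rewrite ler_wpM2l ?ler_wsqrtr // !mulr_ge0 //; lra.
rewrite (@le_trans _ _ (\sum_(0 <= j < b ^ k)
    2 * expR 1 * C * X * mid_weight b k t (d * b ^ k + j))) //.
  by apply: ler_sum_nat => j /andP[_]; exact: badW.
have [_ db'] := andP db.
have := @sum_mid_weight_le R b d k t b1 db'; rewrite gtr0_norm // => /(_ tb) Wle.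
rewrite -mulr_sumr (le_trans (ler_wpM2l _ Wle)) ?mulr_ge0 ?expR_ge0 //.
rewrite tbE (_ : 2^-1 + _ = 1); last by rewrite -rE; field; rewrite gt_eqF.
by rewrite le_eqVlt; apply/orP; left; apply/eqP; ring.
Qed.
(* N = 0 and N = 1 are left out of the counted set: log_b 0 is undefined, and
   log_b 1 = 0 makes the inequality |...| >= 0 hold for N = 1 whatever lambda
   is, while the right-hand side tends to 0 as lambda grows. *)
Theorem theorem4 (R : realType) (p : R) (hp : 1 <= p) :
  exists2 A : R, 0 < A &
    forall (b M : nat) (lambda : R),
      (2 <= b)%N -> (b < M)%N -> 1 <= lambda ->
      M%:R^-1 *
        #|[pred N : 'I_M | (2 <= N)%N &
             `|normDelta b p N
               - (b%:R ^+ 2 - 1) / (12 * b%:R) * logb R b N|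
             >= A * lambda * b%:R * Num.sqrt (logb R b N)]|%:R
      <= expR (- Num.sqrt lambda).
Proof.
(* Twice the constant of [block_concentration]; the 2 comes from [sum_blocks_le]. *)
pose c : R := 8 * expR 1 ^+ 2 * (2 * p) `^ p.
have c0 : 0 <= c by rewrite !mulr_ge0 ?sqr_ge0 ?powR_ge0.
exists (32 * (1 + c)); first lra.
move=> b M lambda b1 bM l1; rewrite -/(vdc_mean R b).
(* Chosen so that [8 * T = 32 * (1 + c) * lambda] and [T / 4 = (1 + c) * lambda]. *)
pose T := 4 * (1 + c) * lambda.
have T4 : 4 <= T.
  have : 0 <= c * lambda by rewrite mulr_ge0 //; lra.
  rewrite /T; lra.
pose bad N := (2 <= N)%N && (`|normDelta b p N - vdc_mean R b * logb R b N|
   >= 8 * T * b%:R * Num.sqrt (logb R b N)).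
rewrite (_ : #|_|%:R = \sum_(0 <= N < M) (bad N)%:R); last first.
  rewrite big_mkord -sum1_card natr_sum big_mkcond /=; apply: eq_bigr => i _.
  rewrite inE /bad /T (_ : 8 * _ = 32 * (1 + c) * lambda); last by ring.
  by case: (_ && _).
have M0 : 0 < M%:R :> R by rewrite ltr0n (leq_ltn_trans _ bM).
rewrite ler_pdivrMl //.
have e0 : 0 <= 4 * expR 1 ^+ 2 * (2 * p) `^ p * expR (- (T / 4)).
  by rewrite !mulr_ge0 ?sqr_ge0 ?powR_ge0 ?expR_ge0.
apply: le_trans (sum_blocks_le b1 e0 _ _ _ _) _ => //.
- by rewrite (leq_ltn_trans _ bM).
(* Below [b] nothing is exceptional, as [8 * T] exceeds the constant 3 of [small_concentration]. *)
- move=> N Nb; rewrite /bad; case: leqP => //= N2.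
  apply/eqP; rewrite pnatr_eq0 eqb0 -ltNge.
  rewrite (lt_le_trans (small_concentration hp _)) ?N2 // ler_wpM2r ?sqrtr_ge0 //.
  by rewrite ler_wpM2r //; lra.
- move=> d k db k0; apply: block_concentration => //; first lra.
  by move=> N /andP[].
rewrite mulrC ler_pM2l //.
(* The constant is absorbed by [c <= expR c]; then [c <= c * lambda] leaves [expR (- lambda)], and
   the root of [lambda] is at most [lambda]. *)
apply: (@le_trans _ _ (expR c * expR (- (T / 4)))).
  rewrite !mulrA -/(c * _) ler_wpM2r ?expR_ge0 //.
  have := expR_ge1Dx c; rewrite /c; lra.
rewrite -expRD ler_expR.
set r := Num.sqrt lambda; have r0 : 0 <= r by exact: sqrtr_ge0.
have rE : r ^+ 2 = lambda by rewrite sqr_sqrtr //; lra.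
have r1 : 1 <= r by rewrite -sqrtr1 ler_wsqrtr.
have rl : r <= lambda by rewrite -rE expr2 ler_peMl.
have cl : c <= c * lambda by rewrite ler_peMr.
rewrite /T; lra.
Qed.
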